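(* Let $k\geq 4$ and let $G$ be a graph with maximum degree $\Delta(G)\le k$ that is $(k-1)$-saturated. Then $G$ is $(1^{k-1},2^{k-1})$-packing colorable.
   Context: Graphs are finite and simple; $\mathrm{dist}(x,y)$ is the usual shortest-path distance. For a non-decreasing sequence of positive integers $S=(s_1,\dots,s_p)$, an $S$-packing coloring of $G$ is a partition of $V(G)$ into sets $V_1,\dots,V_p$ such that any two distinct vertices of $V_i$ are at distance greater than $s_i$, for each $1\le i\le p$; $G$ is $S$-packing colorable if such a partition exists. The notation $i^r$ in a sequence means that $i$ is repeated $r$ times, so $(1^{k-1},2^{k-1})$ is the sequence of $k-1$ ones followed by $k-1$ twos. A vertex of degree $k$ is called a $k$-vertex. A graph $G$ with $\Delta(G)\le k$ is called $t$-saturated ($0\le t\le k$) if every $k$-vertex of $G$ is adjacent to at most $t$ vertices of degree $k$. *)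

(* Defs.v *)
(* A finite simple graph is a symmetric irreflexive [e : rel T]
   on [T : finType]. *)
From mathcomp Require Import all_boot.

Set Implicit Arguments.
Unset Strict Implicit.
Unset Printing Implicit Defensive.

Section Graphs.

Variables (T : finType) (e : rel T).
Implicit Types x y v : T.

Definition neighbors v : {set T} := [set u | e v u].

Definition deg v : nat := #|neighbors v|.

Definition max_degree : nat := \max_(v : T) deg v.

Definition walk_of_length x y (n : nat) : bool :=
  [exists p : n.-tuple T, path e x p && (last x p == y)].

Lemma connect_walk x y : connect e x y -> exists n, walk_of_length x y n.
Proof.
case/connectP=> p e_p ->; exists (size p).
by apply/existsP; exists (in_tuple p); rewrite e_p eqxx.
Qed.

(* [None] stands for infinite distance (distinct connected components). *)
Definition dist x y : option nat :=
  match @idP (connect e x y) with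
  | ReflectT xy => Some (ex_minn (connect_walk xy))
  | ReflectF _ => None
  end.

Definition dist_gt x y (s : nat) : bool :=
  if dist x y is Some d then s < d else true.

Definition saturated (k t : nat) : Prop :=
  forall v, deg v = k -> #|[set u in neighbors v | deg u == k]| <= t.

(* Classes are indexed from 0 and may be empty. *)
Definition packing_coloring (S : seq nat) (V : 'I_(size S) -> {set T}) : Prop :=
  [/\ \bigcup_i V i = [set: T],
      forall i j, i != j -> [disjoint V i & V j]
    & forall i x y, x \in V i -> y \in V i -> x != y -> dist_gt x y (nth 0 S i)].

Definition packing_colorable (S : seq nat) : Prop :=
  exists V : 'I_(size S) -> {set T}, packing_coloring V.

End Graphs.

(* Main.v *)
(* Saturation makes [G] (k-1)-degenerate, hence properly k-colorable; take a
   k-coloring in which one distinguished class [R] is as small as possible.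
   Swapping Kempe chains shows, through Hall's theorem, that [R] can be matched
   into each of the other k-1 classes.  So every [v] in [R] owns k-1 neighbors,
   no vertex being owned twice, and has at most one further neighbor.  Two
   vertices of [R] at distance 2 share a neighbor that is not owned by one of
   them; pointing to its owner defines a digraph of out-degree at most one on
   [R].  Since moreover no vertex has k neighbors in [R], the graph of pairs at
   distance 2 in [R] is (k-2)-degenerate, and [R] splits into k-1 2-packings. *)
Require Import Defs.
From mathcomp Require Import all_boot perm zify.

Set Implicit Arguments.
Unset Strict Implicit.
Unset Printing Implicit Defensive.

Section Hall.

Variables A B : finType.
Implicit Types (N : A -> {set B}) (S : {set A}).

Definition hall_condition N : bool :=
  [forall S : {set A}, #|S| <= #|\bigcup_(a in S) N a|].

Definition remove_choice N a b : A -> {set B} :=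
  fun a' => if a' == a then N a' :\ b else N a'.

Lemma remove_choice_sub N a b a' : remove_choice N a b a' \subset N a'.
Proof. by rewrite /remove_choice; case: eqP; rewrite ?subD1set. Qed.

Lemma remove_choiceP N a b a' b' : b' \in N a' -> (a' != a) || (b' != b) ->
  b' \in remove_choice N a b a'.
Proof. by rewrite /remove_choice; case: eqP => //= _ b'N; rewrite !inE b'N andbT. Qed.

Lemma sum_card_remove_choice N a b : b \in N a ->
  \sum_a' #|remove_choice N a b a'| < \sum_a' #|N a'|.
Proof.
move=> bN; rewrite (bigD1 a) //= [ltnRHS](bigD1 a) //= -addSn leq_add //.
  by rewrite /remove_choice eqxx (cardsD1 b (N a)) bN.
by apply: leq_sum => a' _; apply/subset_leq_card/remove_choice_sub.
Qed.

Lemma remove_choice_violator N a b S : hall_condition N ->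
  #|\bigcup_(a' in S) remove_choice N a b a'| < #|S| -> a \in S.
Proof.
move=> /forallP/(_ S) hallN; apply: contraLR => aS; rewrite -leqNgt.
rewrite (eq_bigr N) // => a' a'S; rewrite /remove_choice.
by case: eqP a'S => // ->; rewrite (negPf aS).
Qed.

(* If [S] and [S'] violate Hall's condition after the removal of [x] and [y]
   respectively, then by submodularity [S :|: S'] or [(S :&: S') :\ a] violates
   it for [N] itself. *)
Lemma hall_condition_remove N a x y : hall_condition N -> x != y ->
  hall_condition (remove_choice N a x) || hall_condition (remove_choice N a y).
Proof.
move=> hallN xy; rewrite -[_ || _]negbK negb_or.
apply/negP => /andP[/forallPn[S ltS] /forallPn[S' ltS']].
rewrite -!ltnNge in ltS ltS'.
have aS := remove_choice_violator hallN ltS.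
have aS' := remove_choice_violator hallN ltS'.
set U := \bigcup_(a' in S) _ in ltS; set U' := \bigcup_(a' in S') _ in ltS'.
have subU : \bigcup_(a' in S :|: S') N a' \subset U :|: U'.
  apply/bigcupsP => a' a'SS'; apply/subsetP => b bN; rewrite inE.
  have [a'a|a'a] := eqVneq a' a; last first.
    move: a'SS'; rewrite inE => /orP[] a'S; apply/orP; [left|right];
      by apply/bigcupP; exists a' => //; apply: remove_choiceP; rewrite ?a'a.
  rewrite a'a in bN; apply/orP; have [bx|bx] := eqVneq b x; [right|left];
    apply/bigcupP; exists a => //; apply: remove_choiceP => //.
    by rewrite bx xy orbT.
  by rewrite bx orbT.
have subI : \bigcup_(a' in (S :&: S') :\ a) N a' \subset U :&: U'.
  apply/bigcupsP => a'; rewrite !inE => /and3P[a'a a'S a'S']; apply/subsetP => b bN.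
  by rewrite inE; apply/andP; split; apply/bigcupP; exists a' => //;
    apply: remove_choiceP; rewrite ?a'a.
have := leq_trans (forallP hallN _) (subset_leq_card subU).
have := leq_trans (forallP hallN _) (subset_leq_card subI).
have := cardsUI S S'; have := cardsUI U U'.
have := cardsD1 a (S :&: S'); rewrite inE aS aS' /=; lia.
Qed.

Lemma hall_marriage N : hall_condition N ->
  exists2 f : A -> B, injective f & forall a, f a \in N a.
Proof.
have [s] := ubnP (\sum_a #|N a|); elim: s N => // s IHs N leNs hallN.
have [/forallP N1|/forallPn[a Na]] := boolP [forall a, #|N a| == 1].
  have /fin_all_exists[f fP] a : exists b, N a = [set b] by apply/cards1P.
  exists f => [a b fab|a]; last by rewrite fP set11.
  apply/eqP/negPn/negP => ab; have := forallP hallN [set a; b].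
  by rewrite cards2 ab big_setU1 ?inE //= big_set1 !fP fab setUid cards1.
have /card_gt1P[x [y [xN yN xy]]] : 1 < #|N a|.
  by have := forallP hallN [set a]; rewrite cards1 big_set1; lia.
have IHremove b : b \in N a -> hall_condition (remove_choice N a b) ->
    exists2 f : A -> B, injective f & forall a', f a' \in N a'.
  move=> bN /IHs[|f f_inj fN]; first by have := sum_card_remove_choice bN; lia.
  by exists f => // a'; apply: subsetP (fN a'); apply: remove_choice_sub.
by have /orP[] := hall_condition_remove a hallN xy; apply: IHremove.
Qed.

End Hall.

Section Degeneracy.

Variables (T : finType) (r : rel T).

Definition degenerate (m : nat) (X : {set T}) : Prop :=
  forall S : {set T}, S \subset X -> S != set0 ->
  exists2 v, v \in S & #|S :&: neighbors r v| <= m.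

Lemma degenerate_coloring (C : finType) m X :
  symmetric r -> irreflexive r -> m < #|C| -> degenerate m X ->
  exists c : {ffun T -> C}, {in X &, forall x y, r x y -> c x != c y}.
Proof.
move=> r_sym r_irr lt_mC; have [s] := ubnP #|X|; elim: s X => // s IHs X leXs dgn.
have [->|Xn0] := eqVneq X set0.
  have /card_gt0P[i0 _] : 0 < #|C| by apply: leq_ltn_trans lt_mC.
  by exists [ffun=> i0] => x y; rewrite inE.
have [v vX v_deg] := dgn X (subxx _) Xn0.
have [||c c_ok] := IHs (X :\ v).
- by move: leXs; rewrite (cardsD1 v) vX.
- by move=> S /subset_trans sS; apply: dgn; apply: sS; apply: subD1set.
have [i i_free] : exists i, i \notin c @: (X :&: neighbors r v).
  have le_m := leq_trans (leq_imset_card c _) v_deg.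
  suff /card_gt0P[i] : 0 < #|~: (c @: (X :&: neighbors r v))|.
    by rewrite inE; exists i.
  by have := cardsC (c @: (X :&: neighbors r v)); lia.
have i_ok y : y \in X -> r v y -> c y != i.
  by move=> yX vy; apply: contraNneq i_free => <-; rewrite imset_f // !inE yX.
exists [ffun x => if x == v then i else c x] => x y xX yX xy; rewrite !ffunE.
have [xv|xv] := eqVneq x v; have [yv|yv] := eqVneq y v.
- by rewrite xv yv r_irr in xy.
- by rewrite eq_sym i_ok // -xv.
- by rewrite i_ok // -yv r_sym.
- by apply: c_ok => //; rewrite !inE ?xv ?yv.
Qed.

End Degeneracy.

Section Distance.

Variables (T : finType) (e : rel T).
Implicit Types x y z : T.

Lemma walk_of_length0 x y : walk_of_length e x y 0 = (x == y).
Proof.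
apply/existsP/eqP => [[p]|->]; last by exists [tuple]; rewrite /= eqxx.
by rewrite tuple0 => /eqP.
Qed.

Lemma walk_of_lengthS x y n :
  walk_of_length e x y n.+1 = [exists z, e x z && walk_of_length e z y n].
Proof.
apply/existsP/existsP => [[p]|[z /andP[xz /existsP[p zy]]]]; last first.
  by exists [tuple of z :: p]; rewrite /= xz.
case/tupleP: p => z p; rewrite /= -andbA => /andP[xz zy].
by exists z; rewrite xz; apply/existsP; exists p.
Qed.

Lemma dist_gtP x y s :
  reflect (forall n, n <= s -> ~~ walk_of_length e x y n) (dist_gt e x y s).
Proof.
rewrite /dist_gt /dist; case: {-}_ / idP => [xy|xy]; last first.
  apply: ReflectT => n _; apply/existsP => -[p /andP[e_p /eqP y_p]].
  by apply: xy; apply/connectP; exists p.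
case: ex_minnP => d walk_d d_min; apply: (iffP idP) => [lt_sd n le_ns|no_walk].
  by apply/negP => /d_min; rewrite leqNgt (leq_ltn_trans le_ns).
by rewrite ltnNge; apply/negP => /no_walk; rewrite walk_d.
Qed.

Lemma dist_gt0 x y : dist_gt e x y 0 = (x != y).
Proof.
by apply/dist_gtP/idP => [/(_ 0 isT)|xy [|//] _]; rewrite walk_of_length0.
Qed.

Lemma dist_gtS x y s :
  dist_gt e x y s.+1 = (x != y) && [forall z, e x z ==> dist_gt e z y s].
Proof.
apply/dist_gtP/andP => [no_walk|[xy /forallP no_walk] [|n]].
- split; first by rewrite -walk_of_length0 no_walk.
  apply/forallP => z; apply/implyP => xz; apply/dist_gtP => n le_ns.
  have := no_walk n.+1 le_ns; rewrite walk_of_lengthS.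
  by apply: contraNN => zy; apply/existsP; exists z; rewrite xz.
- by rewrite walk_of_length0.
- rewrite ltnS walk_of_lengthS => le_ns; apply/existsP => -[z /andP[xz zy]].
  by move/implyP: (no_walk z) => /(_ xz)/dist_gtP/(_ n le_ns)/negP.
Qed.

Lemma dist_gt1 x y : dist_gt e x y 1 = (x != y) && ~~ e x y.
Proof.
rewrite dist_gtS; congr andb; apply/forallP/idP => [no_edge|xy z].
  by have := no_edge y; rewrite dist_gt0 eqxx; case: (e x y).
by rewrite dist_gt0; apply/implyP; apply: contraTneq => ->.
Qed.

Definition share_neighbor : rel T :=
  [rel x y | (x != y) && ~~ [disjoint neighbors e x & neighbors e y]].

Lemma share_neighborP x y :
  reflect (x != y /\ exists2 z, e x z & e y z) (share_neighbor x y).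
Proof.
apply: (iffP andP) => [[xy /pred0Pn[z]]|[xy [z xz yz]]].
  by rewrite /= !inE => /andP[xz yz]; split=> //; exists z.
by split=> //; apply/pred0Pn; exists z; rewrite /= !inE xz.
Qed.

Lemma share_neighbor_sym : symmetric share_neighbor.
Proof. by move=> x y; rewrite /share_neighbor /= eq_sym disjoint_sym. Qed.

Lemma share_neighbor_irr : irreflexive share_neighbor.
Proof. by move=> x; rewrite /share_neighbor /= eqxx. Qed.

Lemma dist_gt2 x y : symmetric e ->
  x != y -> ~~ e x y -> ~~ share_neighbor x y -> dist_gt e x y 2.
Proof.
move=> e_sym xy no_edge no_nbr; rewrite dist_gtS xy /=; apply/forallP => z.
apply/implyP => xz; rewrite dist_gt1; apply/andP; split.
  by apply: contraNneq no_edge => <-.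
apply: contraNN no_nbr => zy; apply/share_neighborP; split=> //.
by exists z; rewrite // e_sym.
Qed.

End Distance.

Section ProperColorings.

Variables (T C : finType) (e : rel T).
Hypothesis e_sym : symmetric e.
Implicit Types (c : {ffun T -> C}) (K : {set T}).

Definition proper_coloring c : bool := [forall x, forall y, e x y ==> (c x != c y)].

Lemma proper_coloringP c :
  reflect (forall x y, e x y -> c x != c y) (proper_coloring c).
Proof. exact: (iffP 'forall_'forall_implyP). Qed.

Definition color_class c i : {set T} := [set x | c x == i].

Definition color_neighbors c i v : {set T} := neighbors e v :&: color_class c i.

Definition class_minimal i c : Prop :=
  proper_coloring c /\
  forall c', proper_coloring c' -> #|color_class c i| <= #|color_class c' i|.

Lemma exists_class_minimal i c : proper_coloring c -> exists c', class_minimal i c'.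
Proof.
by case/(arg_minnP (fun c => #|color_class c i|)) => c' c'_proper c'_min; exists c'.
Qed.

Lemma color_class_stable c i x y : proper_coloring c ->
  x \in color_class c i -> y \in color_class c i -> ~~ e x y.
Proof.
move=> /proper_coloringP c_proper; rewrite !inE => /eqP xi /eqP yi.
by apply/negP => /c_proper; rewrite xi yi eqxx.
Qed.

Definition kempe_closed c i j K : Prop :=
  forall x y, x \in K -> e x y -> c x \in pred2 i j -> c y \in pred2 i j -> y \in K.

Definition kempe_swap c i j K : {ffun T -> C} :=
  [ffun x => if x \in K then tperm i j (c x) else c x].

Lemma kempe_swap_proper c i j K :
  proper_coloring c -> kempe_closed c i j K -> proper_coloring (kempe_swap c i j K).
Proof.
move=> /proper_coloringP c_proper K_closed.
have boundary x y : x \in K -> y \notin K -> e x y -> tperm i j (c x) != c y.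
  move=> xK yK xy; apply: contraNneq yK; case: tpermP => [xi yj|xj yi|_ _ cxy].
  - by apply: (K_closed x); rewrite // ?xi -?yj inE eqxx ?orbT.
  - by apply: (K_closed x); rewrite // ?xj -?yi inE eqxx ?orbT.
  - by have := c_proper x y xy; rewrite cxy eqxx.
apply/proper_coloringP => x y xy; rewrite !ffunE.
case: ifPn => xK; case: ifPn => yK.
- by rewrite (inj_eq perm_inj) c_proper.
- exact: boundary.
- by rewrite eq_sym boundary // e_sym.
- exact: c_proper.
Qed.

Lemma kempe_swap_minimal c z i j K : class_minimal z c -> z != i -> z != j ->
  kempe_closed c i j K -> class_minimal z (kempe_swap c i j K).
Proof.
move=> [c_proper c_min] zi zj K_closed.
split=> [|c' /c_min]; first exact: kempe_swap_proper.
suff -> : color_class (kempe_swap c i j K) z = color_class c z by [].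
apply/setP => x; rewrite !inE ffunE; case: ifP => // _.
by rewrite (canF_eq (tpermK i j)) tpermD // eq_sym.
Qed.

Lemma kempe_card c i j K : class_minimal i c -> kempe_closed c i j K ->
  #|color_class c i :&: K| <= #|color_class c j :&: K|.
Proof.
move=> [c_proper c_min] K_closed.
have := c_min _ (kempe_swap_proper c_proper K_closed).
rewrite -[#|color_class c i|](cardsID K).
rewrite -[#|color_class (kempe_swap _ _ _ _) i|](cardsID K).
have -> : color_class (kempe_swap c i j K) i :\: K = color_class c i :\: K.
  by apply/setP => x; rewrite !inE ffunE; case: (x \in K).
have -> : color_class (kempe_swap c i j K) i :&: K = color_class c j :&: K.
  apply/setP => x; rewrite !inE ffunE; case: (x \in K); rewrite ?andbF //.
  by rewrite (canF_eq (tpermK i j)) tpermL.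
by rewrite leq_add2r.
Qed.

Lemma color_neighbors_gt0 c i j v : class_minimal i c -> i != j ->
  v \in color_class c i -> 0 < #|color_neighbors c j v|.
Proof.
move=> c_min ij v_i; rewrite card_gt0; apply/eqP => N0.
have v_closed : kempe_closed c i j [set v].
  move=> x y /set1P-> vy _ /pred2P[] cy.
    have v_y : y \in color_class c i by rewrite inE cy.
    by have := color_class_stable c_min.1 v_i v_y; rewrite vy.
  by have := in_set0 y; rewrite -N0 !inE vy cy eqxx.
have := kempe_card c_min v_closed; rewrite (setIidPr _) ?sub1set // cards1.
rewrite (_ : _ :&: _ = set0) ?cards0 //; apply/setP => x; rewrite !inE.
by apply/andP => -[/eqP xj /eqP xv]; move: v_i; rewrite inE -xv xj eq_sym (negPf ij).
Qed.

End ProperColorings.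

Section Saturation.

Variables (T : finType) (e : rel T) (m : nat).
Hypotheses (deg_le : forall v, deg e v <= m.+1) (e_sat : saturated e m.+1 m).

Lemma saturated_low_degree_neighbor v : deg e v = m.+1 ->
  exists2 w, e v w & deg e w <= m.
Proof.
move=> v_deg.
have /subsetPn[w] :
    ~~ (neighbors e v \subset [set u in neighbors e v | deg e u == m.+1]).
  by apply/negP => /subset_leq_card; rewrite -/(deg e v) v_deg ltnNge e_sat.
rewrite !inE => vw; rewrite vw /= => w_deg.
by exists w; rewrite // -ltnS ltn_neqAle w_deg deg_le.
Qed.

Lemma saturated_degenerate (X : {set T}) : degenerate e m X.
Proof.
move=> S _ /set0Pn[v vS].
have [/exists_inP[w wS w_deg]|/exists_inPn high] := boolP [exists w in S, deg e w <= m].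
  by exists w => //; apply: leq_trans w_deg; rewrite subset_leq_card ?subsetIr.
have v_deg : deg e v = m.+1.
  by apply/eqP; rewrite eqn_leq deg_le ltnNge high.
have [w vw w_deg] := saturated_low_degree_neighbor v_deg.
exists v => //; rewrite -ltnS -v_deg; apply/proper_card/properP.
split; first exact: subsetIr.
by exists w; rewrite !inE vw // andbT; apply: contraL w_deg => /high.
Qed.

Lemma saturated_coloring (C : finType) : symmetric e -> irreflexive e -> m < #|C| ->
  exists c : {ffun T -> C}, proper_coloring e c.
Proof.
move=> e_sym e_irr lt_mC.
have [c c_ok] :=
  degenerate_coloring e_sym e_irr lt_mC (saturated_degenerate (X := setT)).
by exists c; apply/proper_coloringP => x y; apply: c_ok.
Qed.

End Saturation.

(* The palette is [D] together with the color [None] of the class to be minimized. *)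
Section MinimalSpareClass.

Variables (T D : finType) (e : rel T) (c : {ffun T -> option D}).
Hypotheses (e_sym : symmetric e) (deg_le : forall v, deg e v <= #|D|.+1).
Hypothesis c_min : class_minimal e None c.

Let R := color_class c None.
Let N i v := color_neighbors e c (Some i) v.

Lemma color_neighbors_deg i v : v \in R -> #|D|.-1 + #|N i v| <= deg e v.
Proof.
move=> vR; rewrite addnC /deg -(cardsID (color_class c (Some i)) (neighbors e v)).
rewrite leq_add2l.
have other_colors : [set Some j | j in [set~ i]] \subset
    c @: (neighbors e v :\: color_class c (Some i)).
  apply/subsetP => _ /imsetP[j ji ->].
  have /card_gt0P[u] := color_neighbors_gt0 e_sym c_min (isT : None != Some j) vR.
  rewrite !inE in ji *; case/andP=> vu /eqP uj; rewrite -uj.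
  by apply: imset_f; rewrite !inE vu uj andbT (inj_eq Some_inj).
have := leq_trans (subset_leq_card other_colors) (leq_imset_card _ _).
by rewrite card_imset ?cardsC1 //; apply: Some_inj.
Qed.

Lemma color_neighbors_le2 i v : v \in R -> #|N i v| <= 2.
Proof. by move=> /(color_neighbors_deg i); have := deg_le v; lia. Qed.

Lemma color_neighbors_bigcup_card i (A : {set T}) : A \subset R ->
  {in R :\: A, forall v, [disjoint N i v & \bigcup_(w in A) N i w]} ->
  #|A| <= #|\bigcup_(v in A) N i v|.
Proof.
set U := \bigcup_(v in A) N i v => sAR AU.
have U_color u : u \in U -> c u = Some i.
  by case/bigcupP=> v _; rewrite !inE => /andP[_ /eqP].
have A_color v : v \in A -> c v = None by move/(subsetP sAR); rewrite inE => /eqP.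
have closed : kempe_closed e c None (Some i) (A :|: U).
  move=> x y; rewrite !inE => /orP[xA|xU] xy _ /pred2P[] cy.
  - by have /proper_coloringP/(_ x y xy) := c_min.1; rewrite A_color ?cy.
  - by apply/orP; right; apply/bigcupP; exists x; rewrite // !inE xy cy /=.
  - apply/orP; left; apply: contraTT (xU) => yA.
    have /AU/disjointFr-> // : y \in R :\: A by rewrite !inE yA cy.
    by rewrite !inE e_sym xy U_color /=.
  - by have /proper_coloringP/(_ x y xy) := c_min.1; rewrite U_color ?cy ?eqxx.
apply: leq_trans (leq_trans (kempe_card e_sym c_min closed) _).
  by apply: subset_leq_card; rewrite subsetI sAR subsetUl.
apply: subset_leq_card; apply/subsetP => x; rewrite !inE => /andP[/eqP cx].
by case/orP=> // /A_color; rewrite cx.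
Qed.

(* A maximal violator is a union of Kempe chains, because adding to it a vertex
   adjacent to its neighborhood brings at most one new vertex of color [i]. *)
Lemma color_neighbors_hall i (A : {set T}) :
  A \subset R -> #|A| <= #|\bigcup_(v in A) N i v|.
Proof.
pose violator (M : {set T}) := (M \subset R) && (#|\bigcup_(v in M) N i v| < #|M|).
move=> sAR; rewrite leqNgt; apply/negP => ltA.
have /maxset_exists[M /maxsetP[/andP[sMR ltM] M_max] _] : violator A by apply/andP.
move: (ltM); rewrite ltnNge => /negP; apply.
apply: color_neighbors_bigcup_card => // v /setDP[vR vM].
apply/pred0Pn => -[u uP].
have : v |: M = M.
  apply: M_max (subsetUr _ _).
  rewrite /violator subUset sub1set vR sMR cardsU1 vM bigcup_setU big_set1 cardsU.
  have : 0 < #|N i v :&: \bigcup_(w in M) N i w|.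
    by apply/card_gt0P; exists u; rewrite inE.
  by have := color_neighbors_le2 i vR; lia.
by move/setP/(_ v); rewrite setU11 (negPf vM).
Qed.

Lemma color_class_matching i :
  exists2 f : T -> T, {in R &, injective f} & {in R, forall v, f v \in N i v}.
Proof.
pose NR (v : {v | v \in R}) := N i (val v).
have [|f f_inj fN] := @hall_marriage _ _ NR.
  apply/forallP => S; rewrite -(card_imset _ val_inj).
  have <- : \bigcup_(v in val @: S) N i v = \bigcup_(v in S) NR v.
    by rewrite big_imset //= => v w _ _; apply: val_inj.
  by apply: color_neighbors_hall; apply/subsetP => _ /imsetP[v _ ->]; apply: valP.
exists (fun v => oapp f v (insub v)) => [v w vR wR|v vR].
  by rewrite !insubT /= => /f_inj[].
by rewrite insubT; apply: fN.
Qed.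

Lemma exists_owned_neighbors :
  exists2 owned : T -> {set T},
    {in R, forall v, #|neighbors e v :\: owned v| <= 1} &
    {in R &, forall v w, v != w -> [disjoint owned v & owned w]}.
Proof.
have /fin_all_exists2[f f_inj fN] := color_class_matching.
have f_color i v : v \in R -> c (f i v) = Some i.
  by move/fN=> /(_ i); rewrite !inE => /andP[_ /eqP].
exists (fun v => [set f i v | i in D]) => [v vR|v w vR wR vw].
  have sub : [set f i v | i in D] \subset neighbors e v.
    by apply/subsetP => _ /imsetP[i _ ->]; case/setIP: (fN i v vR).
  rewrite cardsD (setIidPr sub) card_imset.
    by rewrite leq_subLR addn1; apply: deg_le.
  by move=> i j /(congr1 c); rewrite !f_color // => -[].
apply/pred0Pn => -[_ /andP[/imsetP[i _ ->] /imsetP[j _ fij]]].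
have ij : i = j by apply: Some_inj; rewrite -(f_color i v) // fij f_color.
by move: vw; rewrite -ij in fij; rewrite (f_inj i v w) ?eqxx.
Qed.

(* If all neighbors of [u] lay in [R], changing the color of [u] within [D] would
   leave [v] without neighbors of its former color, against [color_neighbors_gt0]. *)
Lemma low_degree_neighbor_outside u v : 1 < #|D| ->
  u \notin R -> e u v -> deg e v <= #|D| -> ~~ (neighbors e u \subset R).
Proof.
move=> D_gt1 uR uv v_deg; apply/negP => /subsetP NuR.
have vR : v \in R by apply: NuR; rewrite inE.
have [i ui] : exists i, c u = Some i.
  by move: uR; rewrite inE; case: (c u) => // i; exists i.
have [j ji] : exists j, j != i.
  have /card_gt0P[j] : 0 < #|[set~ i]| by rewrite cardsC1; lia.
  by rewrite !inE; exists j.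
have u_closed : kempe_closed e c (Some i) (Some j) [set u].
  move=> x y /set1P-> uy _; have cy : c y = None.
    by apply/eqP; have := NuR y; rewrite !inE; apply.
  by rewrite cy.
pose c' := kempe_swap c (Some i) (Some j) [set u].
have c'_min : class_minimal e None c' by apply: kempe_swap_minimal.
have c'E x : c' x = if x == u then Some j else c x.
  by rewrite ffunE inE; case: eqP => // ->; rewrite ui tpermL.
have : 0 < #|color_neighbors e c' (Some i) v|.
  apply: color_neighbors_gt0 c'_min _ _ => //.
  have vu : (v == u) = false by apply: contraNF uR => /eqP <-.
  by move: vR; rewrite !inE c'E vu.
case/card_gt0P=> w; rewrite !inE c'E => /andP[vw].
have [_ /eqP[/eqP]|wu wi] := eqVneq w u; first by rewrite (negPf ji).
have : 1 < #|N i v|.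
  apply/card_gt1P; exists u, w; rewrite !inE vw wi e_sym uv ui eqxx eq_sym.
  by split.
by have := color_neighbors_deg i vR; lia.
Qed.

Lemma card_spare_class_neighbors u : 1 < #|D| -> saturated e #|D|.+1 #|D| ->
  #|R :&: neighbors e u| <= #|D|.
Proof.
move=> D_gt1 e_sat; rewrite leqNgt; apply/negP => lt_D.
have u_deg : deg e u = #|D|.+1.
  by apply/eqP; rewrite eqn_leq deg_le (leq_trans lt_D) // subset_leq_card ?subsetIr.
have NuR : neighbors e u \subset R.
  by apply/setIidPr/eqP; rewrite eqEcard subsetIr (leq_trans (deg_le u)).
have [v uv v_deg] := saturated_low_degree_neighbor deg_le e_sat u_deg.
have vR : v \in R by apply: (subsetP NuR); rewrite inE.
have uR : u \notin R.
  by apply/negP => uR; have := color_class_stable c_min.1 uR vR; rewrite uv.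
by have := low_degree_neighbor_outside D_gt1 uR uv v_deg; rewrite NuR.
Qed.

End MinimalSpareClass.

Lemma functional_onto_graph (T : finType) (r : rel T) (S : {set T}) :
  {in S & &, forall v w w', r v w -> r v w' -> w = w'} ->
  {in S, forall w, exists2 v, v \in S & r v w} ->
  exists2 h : T -> T, {in S, forall v, h v \in S} &
    {in S &, forall v w, r v w = (v == h w)}.
Proof.
move=> r_functional r_onto.
have /fin_all_exists[h hP] w : exists v, w \in S -> v \in S /\ r v w.
  have [wS|wS] := boolP (w \in S); last by exists w.
  by have [v vS vw] := r_onto w wS; exists v.
have h_inj : {in S &, injective h}.
  move=> v w vS wS hvw; have [hvS rv] := hP v vS; have [_ rw] := hP w wS.
  by apply: (r_functional (h v)) => //; rewrite hvw.
have h_onto : h @: S = S.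
  apply/eqP; rewrite eqEcard card_in_imset // leqnn andbT.
  by apply/subsetP => _ /imsetP[w /hP[hwS _] ->].
exists h => [w /hP[]//|v w vS wS].
apply/idP/eqP => [rvw|->]; last by have [] := hP w wS.
move: vS rvw; rewrite -[in v \in S]h_onto => /imsetP[w' w'S ->] rhw.
have [hw'S rhw'] := hP w' w'S.
by rewrite (r_functional (h w') w w').
Qed.

Section OwnedNeighbors.

Variables (T : finType) (e : rel T) (R : {set T}) (owned : T -> {set T}) (m : nat).

Let extra v := neighbors e v :\: owned v.

Hypothesis e_sym : symmetric e.
Hypothesis extra_le1 : {in R, forall v, #|extra v| <= 1}.
Hypothesis owned_disjoint :
  {in R &, forall v w, v != w -> [disjoint owned v & owned w]}.

Definition arc v w : bool := ~~ [disjoint extra v & owned w].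

Lemma arcP v w : reflect (exists2 u, u \in extra v & u \in owned w) (arc v w).
Proof.
by apply: (iffP pred0Pn) => [[u /andP[]]|[u uv uw]]; exists u; rewrite //= uv.
Qed.

Lemma extra_unique v u u' : v \in R -> u \in extra v -> u' \in extra v -> u = u'.
Proof. by move=> vR uv u'v; apply: (card_le1_eqP (extra_le1 vR)). Qed.

Lemma owner_unique v w u : v \in R -> w \in R ->
  u \in owned v -> u \in owned w -> v = w.
Proof.
move=> vR wR uv uw; apply/eqP/negPn/negP => /(owned_disjoint vR wR) vw.
by rewrite (disjointFr vw uv) in uw.
Qed.

Lemma arc_functional : {in R & &, forall v w w', arc v w -> arc v w' -> w = w'}.
Proof.
move=> v w w' vR wR w'R /arcP[u uv uw] /arcP[u' u'v u'w'].
by apply: (owner_unique wR w'R uw); rewrite (extra_unique vR uv u'v).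
Qed.

Lemma arc_common_neighbor v w u : v \in R -> w \in R -> v != w ->
  u \in owned v -> e w u -> arc w v.
Proof.
move=> vR wR vw uv wu; apply/arcP; exists u; rewrite // !inE wu andbT.
by apply: contra vw => /(owner_unique vR wR uv) ->.
Qed.

Lemma no_in_arc_degree (S : {set T}) v :
  (forall u, #|R :&: neighbors e u| <= m.+1) ->
  S \subset R -> v \in S -> {in S, forall w, ~~ arc w v} ->
  #|S :&: neighbors (share_neighbor e) v| <= m.
Proof.
move=> R_nbrs /subsetP sSR vS no_in_arc.
have shared_extra w u : w \in S -> v != w -> e v u -> e w u -> u \in extra v.
  move=> wS vw vu wu; rewrite !inE vu andbT.
  by apply: contraNN (no_in_arc w wS) => /arc_common_neighbor; apply; rewrite ?sSR.
have [extra0|[u uv]] := set_0Vmem (extra v).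
  rewrite (_ : _ :&: _ = set0) ?cards0 //; apply/setP => w.
  rewrite !inE; apply/negP => /andP[wS /share_neighborP[vw [u vu wu]]].
  by have := shared_extra w u wS vw vu wu; rewrite extra0 inE.
have vu : e v u by move: uv; rewrite !inE => /andP[].
have := R_nbrs u.
rewrite (cardsD1 v) !inE sSR // e_sym vu ltnS; apply: leq_trans.
apply/subset_leq_card/subsetP => w; rewrite !inE.
case/andP=> wS /share_neighborP[vw [u' vu' wu']].
rewrite eq_sym vw sSR // e_sym.
by rewrite (extra_unique (sSR v vS) uv (shared_extra w u' wS vw vu' wu')) wu'.
Qed.

Lemma all_in_arcs_degree (S : {set T}) : S \subset R -> S != set0 ->
  {in S, forall v, exists2 w, w \in S & arc w v} ->
  exists2 v, v \in S & #|S :&: neighbors (share_neighbor e) v| <= 2.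
Proof.
move=> /subsetP sSR /set0Pn[x xS] in_arcs.
have arcS_functional : {in S & &, forall v w w', arc v w -> arc v w' -> w = w'}.
  by move=> v w w' vS wS w'S; apply: arc_functional; apply: sSR.
have [h hS arcE] := functional_onto_graph arcS_functional in_arcs.
have hxS := hS x xS; exists (h x) => //.
have arc_hx : arc (h x) x by rewrite arcE.
apply: leq_trans (_ : #|[set x; h (h x)]| <= 2); last first.
  by rewrite cards2; case: (_ != _).
apply/subset_leq_card/subsetP => w; rewrite !inE.
case/andP=> wS /share_neighborP[hxw [u hxu wu]].
have [u_owned|u_owned] := boolP (u \in owned (h x)).
  have : arc w (h x) by apply: arc_common_neighbor u_owned wu; rewrite ?sSR.
  by rewrite arcE // => ->; rewrite orbT.
have u_owned_x : u \in owned x.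
  have u_extra : u \in extra (h x) by rewrite !inE u_owned.
  have /arcP[u' u'_extra u'owned] := arc_hx.
  by rewrite (extra_unique (sSR _ hxS) u_extra u'_extra).
apply/orP; left; apply: contraNT hxw => wx.
rewrite eq_sym -arcE //; apply: arc_common_neighbor u_owned_x wu; rewrite ?sSR //.
by rewrite eq_sym.
Qed.

Lemma owned_neighbors_degenerate : 1 < m ->
  (forall u, #|R :&: neighbors e u| <= m.+1) ->
  degenerate (share_neighbor e) m R.
Proof.
move=> m_gt1 R_nbrs S sSR Sn0.
have [/exists_inP[v vS /exists_inPn no_in_arc]|/exists_inPn in_arcs] :=
  boolP [exists v in S, ~~ [exists w in S, arc w v]].
  by exists v => //; apply: no_in_arc_degree.
have [v vS|v vS v_le2] := all_in_arcs_degree sSR Sn0.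
  by have := in_arcs v vS; rewrite negbK => /exists_inP.
by exists v => //; apply: leq_trans m_gt1.
Qed.

End OwnedNeighbors.

Section PackingColorings.

Variables (T : finType) (e : rel T).

Lemma packing_colorableP (S : seq nat) (f : T -> 'I_(size S)) :
  (forall x y, x != y -> f x = f y -> dist_gt e x y (nth 0 S (f x))) ->
  packing_colorable e S.
Proof.
move=> f_dist; exists (fun i => [set x | f x == i]); split.
- by apply/setP => x; rewrite inE; apply/bigcupP; exists (f x); rewrite ?inE.
- move=> i j ij; apply/pred0Pn => -[x /andP[]]; rewrite !inE => /eqP-> /eqP.
  exact/eqP.
- move=> i x y; rewrite !inE => /eqP <- /eqP fyx xy.
  exact: f_dist.
Qed.

Lemma packing_colorable_cat_nseq (a b s t : nat) (f : T -> 'I_a + 'I_b) :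
  (forall x y, x != y -> f x = f y -> dist_gt e x y (if f x is inl _ then s else t)) ->
  packing_colorable e (nseq a s ++ nseq b t).
Proof.
have size_ab : a + b = size (nseq a s ++ nseq b t) by rewrite size_cat !size_nseq.
move=> f_dist.
apply: (@packing_colorableP _ (fun x => cast_ord size_ab (unsplit (f x)))).
move=> x y xy /cast_ord_inj/(can_inj unsplitK)/(f_dist x y xy).
rewrite nth_cat size_nseq; case: (f x) => i /=.
  by rewrite ltn_ord nth_nseq ltn_ord.
by rewrite ltnNge leq_addr /= addKn nth_nseq ltn_ord.
Qed.

Lemma packing_colorable_split (a b : nat)
    (c : {ffun T -> option 'I_a}) (d : T -> 'I_b) :
  symmetric e -> proper_coloring e c ->
  {in color_class c None &, forall x y, share_neighbor e x y -> d x != d y} ->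
  packing_colorable e (nseq a 1 ++ nseq b 2).
Proof.
move=> e_sym c_proper d_proper.
apply: (@packing_colorable_cat_nseq _ _ _ _
  (fun x => if c x is Some i then inl i else inr (d x))) => x y xy.
case cx: (c x) => [i|]; case cy: (c y) => [j|] // -[xy_eq].
  rewrite dist_gt1 xy; apply/negP => /(proper_coloringP _ _ c_proper x y).
  by rewrite cx cy xy_eq eqxx.
have [xR yR] : x \in color_class c None /\ y \in color_class c None.
  by rewrite !inE cx cy.
apply: dist_gt2 => //; first exact: color_class_stable c_proper xR yR.
by apply/negP => /(d_proper x y xR yR); rewrite xy_eq eqxx.
Qed.

End PackingColorings.

Theorem theorem4p1 (k : nat) (T : finType) (e : rel T)
    (k_ge4 : 4 <= k)
    (e_sym : symmetric e) (e_irr : irreflexive e)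
    (e_max : max_degree e <= k)
    (e_sat : saturated e k (k - 1)) :
  packing_colorable e (nseq (k - 1) 1 ++ nseq (k - 1) 2).
Proof.
case: k k_ge4 e_max e_sat => [|[|n]] // n_gt1 e_max; rewrite subSS subn0 => e_sat.
have deg_le v : deg e v <= n.+2 by apply: leq_trans e_max; apply: leq_bigmax.
have [|c0] := saturated_coloring (C := option 'I_n.+1) deg_le e_sat e_sym e_irr.
  by rewrite card_option card_ord.
case/(exists_class_minimal None) => c c_min.
have deg_le_card v : deg e v <= #|'I_n.+1|.+1 by rewrite card_ord.
have [owned extra_le1 owned_disjoint] := exists_owned_neighbors e_sym deg_le_card c_min.
have R_nbrs u : #|color_class c None :&: neighbors e u| <= n.+1.
  have := card_spare_class_neighbors e_sym deg_le_card c_min u.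
  by rewrite card_ord; apply; first exact: leqW.
have [|d d_proper] := degenerate_coloring (C := 'I_n.+1)
  (@share_neighbor_sym _ e) (@share_neighbor_irr _ e) _
  (owned_neighbors_degenerate e_sym extra_le1 owned_disjoint n_gt1 R_nbrs).
  by rewrite card_ord.
exact: packing_colorable_split e_sym c_min.1 d_proper.
Qed.
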